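(* Let $q$ be a complex number with $q\neq 0,1$, let $m,r$ be complex numbers, and write $[j]_q=\frac{q^j-1}{q-1}$. For all integers $0\le k\le n$, the $(q,r)$-Whitney numbers of the second kind satisfy $$W_{m,r,q}(n,k)=q^{\binom{k}{2}}\sum_{0\leq j_1\leq j_2\leq \cdots\leq j_{n-k}\leq k}\ \prod_{i=1}^{n-k}\big(m[j_i]_q+r\big).$$
   Context: The $(q,r)$-Whitney numbers of the second kind $W_{m,r,q}(n,k)$ are defined as the coefficients in $(ma^\dagger a+r)^n=\sum_{k=0}^{n}m^kW_{m,r,q}(n,k)(a^\dagger)^k a^k$, where $a^\dagger,a$ are $q$-boson operators satisfying $aa^\dagger-qa^\dagger a=1$. Equivalently, they are the unique numbers with $W_{m,r,q}(0,0)=1$, $W_{m,r,q}(n,k)=0$ for $k<0$ or $k>n$, and the recurrence $W_{m,r,q}(n+1,k)=q^{k-1}W_{m,r,q}(n,k-1)+(m[k]_q+r)W_{m,r,q}(n,k)$ for $n\ge 0$. When $n=k$ the sum consists of the empty product $1$. *)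

(* Defs.v *)
From HB Require Import structures.
From mathcomp Require Import all_boot all_order all_algebra.
From mathcomp Require Import boolp functions.
From mathcomp Require Import ring.

Set Implicit Arguments.
Unset Strict Implicit.
Unset Printing Implicit Defensive.

Import GRing.Theory.
Local Open Scope ring_scope.

Definition qnum (F : fieldType) (q : F) (j : nat) : F :=
  (q ^+ j - 1) / (q - 1).

(* W_{m,r,q}(n, k); the term q^(k-1) W(n, k-1) of the recurrence vanishes at
   k = 0 because W(n, -1) = 0.  The recurrence also gives a value for m = 0,
   where the normal ordering below does not determine the coefficients.  For
   m != 0 the two characterizations agree: see qrWhitney2_normal_ordering and
   qrWhitney2_unique. *)
Fixpoint qrWhitney2 (F : fieldType) (m r q : F) (n k : nat) : F :=
  if n is n'.+1 then
    (if k is k'.+1 then q ^+ k' * qrWhitney2 m r q n' k' else 0)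
    + (m * qnum q k + r) * qrWhitney2 m r q n' k
  else (k == 0)%:R.

Definition qboson (F : fieldType) (q : F) (V : lmodType F)
    (adag a : {linear V -> V}) : Prop :=
  forall v : V, a (adag v) - q *: adag (a v) = v.

(* (m a^dagger a + r)^n = \sum_k m^k W(n, k) (a^dagger)^k a^k for all q-boson
   operators. *)
Definition normal_ordering (F : fieldType) (m r q : F) (W : nat -> nat -> F)
    : Prop :=
  forall (V : lmodType F) (adag a : {linear V -> V}), qboson q adag a ->
  forall (n : nat) (v : V),
    iter n (fun u => m *: adag (a u) + r *: u) v =
    \sum_(k < n.+1) (m ^+ k * W n k) *: iter k adag (iter k a v).

Lemma qrWhitney2_small (F : fieldType) (m r q : F) n k :
  (n < k)%N -> qrWhitney2 m r q n k = 0.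
Proof.
elim: n k => [|n IHn] [|k] //= ltnk.
by rewrite !IHn ?mulr0 ?addr0 // ltnW.
Qed.

Lemma qnumS (F : fieldType) (q : F) j : q != 1 ->
  qnum q j.+1 = 1 + q * qnum q j.
Proof. by rewrite -subr_eq0 /qnum exprS => q1; field. Qed.

Lemma qboson_iter (F : fieldType) (q : F) (V : lmodType F)
    (adag a : {linear V -> V}) k v : q != 1 -> qboson q adag a ->
  adag (a (iter k adag v)) =
  qnum q k *: iter k adag v + q ^+ k *: iter k.+1 adag (a v).
Proof.
move=> q1 qb; elim: k => [|k IHk].
  by rewrite /qnum expr0 subrr mul0r scale0r add0r scale1r.
have /eqP := qb (iter k adag v); rewrite subr_eq => /eqP /= ->.
rewrite IHk (qnumS _ q1) !linearD !linearZ /=.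
by rewrite exprS scalerDl scale1r !scalerA addrA.
Qed.

Lemma qrWhitney2_normal_ordering (F : fieldType) (m r q : F) : q != 1 ->
  normal_ordering m r q (qrWhitney2 m r q).
Proof.
move=> q1 V adag a qb n v; pose M k := iter k adag (iter k a v).
elim: n => [|n IHn]; first by rewrite big_ord1 /= expr0 mulr1 scale1r.
rewrite iterS IHn (linear_sum a) (linear_sum adag) !scaler_sumr -big_split /=.
pose G k : V := (m ^+ k * ((m * qnum q k + r) * qrWhitney2 m r q n k)) *: M k.
pose H k : V := (m ^+ k.+1 * (q ^+ k * qrWhitney2 m r q n k)) *: M k.+1.
transitivity (\sum_(k < n.+1) (G k + H k)).
  apply: eq_bigr => k _; rewrite !linearZ /= (qboson_iter _ _ q1 qb).
  rewrite -[iter k adag _]/(M k) -[iter k.+1 _ _]/(M k.+1) /G /H.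
  rewrite !scalerDr !scalerA addrAC -scalerDl exprS.
  by congr (_ *: _ + _ *: _); ring.
rewrite big_split /= [RHS]big_ord_recl /= -/(M 0).
have -> : \sum_(k < n.+1) G k = G 0 + \sum_(k < n.+1) G k.+1.
  rewrite big_ord_recl [in RHS]big_ord_recr /= [G n.+1]/G.
  by rewrite qrWhitney2_small // !mulr0 scale0r addr0.
rewrite -addrA -big_split /= add0r; congr (_ + _).
apply: eq_bigr => k _; rewrite /G /H -scalerDl.
by rewrite addrC -mulrDr.
Qed.

(* A concrete q-boson pair in which the normally ordered monomials
   (a^dagger)^k a^k are linearly independent for every q, roots of unity
   included: left multiplication of a^dagger and a on combinations of the
   (a^dagger)^i a^j, given by their coefficients. *)
Section NormalOrderedModel.
Variables (F : fieldType) (q : F).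

Definition model : Type := nat -> nat -> F^o.
HB.instance Definition _ := GRing.Lmodule.on model.

Definition model_adag (f : model) : model :=
  fun i j => if i is i'.+1 then f i' j else 0.

Definition model_a (f : model) : model := fun i j =>
  qnum q i.+1 * f i.+1 j + q ^+ i * (if j is j'.+1 then f i j' else 0).

Fact model_adag_linear : linear model_adag.
Proof.
move=> c f g; apply/funext => i; apply/funext => j.
by case: i => [|i]; rewrite /model_adag ?fctE //= scaler0 addr0.
Qed.

Fact model_a_linear : linear model_a.
Proof.
move=> c f g; apply/funext => i; apply/funext => j.
case: j => [|j]; rewrite /model_a !fctE /= /GRing.scale /=; ring.
Qed.

HB.instance Definition _ :=
  GRing.isLinear.Build F model model *:%R model_adag model_adag_linear.
HB.instance Definition _ :=
  GRing.isLinear.Build F model model *:%R model_a model_a_linear.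

Fact model_qboson : q != 1 -> qboson q model_adag model_a.
Proof.
move=> q1 f; apply/funext => i; apply/funext => j.
change (model_a (model_adag f) i j - q * model_adag (model_a f) i j = f i j).
rewrite /model_adag /model_a.
have q0 : qnum q 0 = 0 by rewrite /qnum expr0 subrr mul0r.
case: i j => [|i] [|j] /=; rewrite (qnumS _ q1) ?q0 ?exprS; ring.
Qed.

Definition model_basis (i0 j0 : nat) : model :=
  fun i j => ((i == i0) && (j == j0))%:R.

Fact iter_model_a k :
  iter k model_a (model_basis 0 0) = model_basis 0 k.
Proof.
elim: k => //= k ->; apply/funext => i; apply/funext => j.
rewrite /model_a /model_basis /= mulr0 add0r.
by case: i j => [|i] [|j] //=; rewrite ?expr0 ?mul1r ?mulr0.
Qed.

Fact iter_model_adag k l :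
  iter k model_adag (model_basis 0 l) = model_basis k l.
Proof.
elim: k => //= k ->; apply/funext => i; apply/funext => j.
by case: i => [|i].
Qed.

End NormalOrderedModel.

Lemma qrWhitney2_unique (F : fieldType) (m r q : F) (W : nat -> nat -> F) :
  m != 0 -> q != 1 -> normal_ordering m r q W ->
  forall n k, (k <= n)%N -> W n k = qrWhitney2 m r q n k.
Proof.
move=> m0 q1 normW n k lekn.
have mono (W' : nat -> nat -> F) : normal_ordering m r q W' ->
    m ^+ k * W' n k =
    iter n (fun u => m *: model_adag (model_a q u) + r *: u)
      (model_basis F 0 0) k k.
  move=> /(_ (model F) (@model_adag F) (model_a q) (model_qboson q1) n) ->.
  transitivity (\sum_(l < n.+1) (m ^+ l * W' n l) * model_basis F l l k k).
    rewrite (bigD1 (Ordinal (lekn : (k < n.+1)%N))) //= /model_basis !eqxx.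
    rewrite mulr1 big1 ?addr0 // => l /negPf; rewrite -val_eqE /= eq_sym => ->.
    by rewrite mulr0.
  have sumE (s : seq 'I_n.+1) (f : 'I_n.+1 -> model F) :
    (\sum_(l <- s) f l) k k = \sum_(l <- s) f l k k.
    by elim: s => [|x s IHs]; rewrite ?big_nil // !big_cons -IHs.
  rewrite sumE; apply: eq_bigr => l _.
  by rewrite iter_model_a iter_model_adag.
apply: (mulfI (expf_neq0 k m0)).
by rewrite !mono //; apply: qrWhitney2_normal_ordering.
Qed.

(* Main.v *)
(** Sorting by the last entry, the sum over weakly increasing [d]-tuples in
    [0 .. b] of the product of the values of [f], that is the complete
    homogeneous symmetric polynomial [h_d (f 0, ..., f b)], satisfies
    [h_(d+1)(b) = \sum_(x <= b) f x * h_d(x)].  Hence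
    [h_(d+1)(b+1) = h_(d+1)(b) + f (b+1) * h_d(b+1)], which is the Whitney
    recurrence up to the factor [q^C(k,2)]. *)
Require Import Defs.
From mathcomp Require Import all_boot all_order all_algebra.
From mathcomp Require Import reals complex.
From mathcomp Require Import ring.

Import GRing.Theory.
Local Open Scope ring_scope.

Section CompleteHomogeneous.
Variables (A : comNzRingType) (f : nat -> A).

Fixpoint hsum (d b : nat) : A :=
  if d is d'.+1 then \sum_(x < b.+1) f x * hsum d' x else 1.

Lemma hsumSS d b : hsum d.+1 b.+1 = hsum d.+1 b + f b.+1 * hsum d b.+1.
Proof. exact: big_ord_recr. Qed.

Lemma hsumS0 d : hsum d.+1 0 = f 0 * hsum d 0.
Proof. exact: big_ord1. Qed.

Lemma big_tupleS (T : finType) d (P : pred (seq T)) (F : seq T -> A) :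
  \sum_(j : d.+1.-tuple T | P j) F j =
  \sum_x \sum_(j : d.-tuple T | P (x :: j)) F (x :: j).
Proof.
rewrite pair_big_dep /= (reindex (fun p : T * d.-tuple T => cons_tuple p.1 p.2)).
  exact: eq_bigl.
exists (fun t => (thead t, behead_tuple t)) => [[x t]|t] _.
  by congr pair; apply: val_inj.
by rewrite [RHS](tuple_eta t); apply: val_inj.
Qed.

(** A weakly decreasing tuple has its largest entry first, so splitting off the head [x] leaves a
    tuple bounded by [x], as in [hsum]. The alphabet ['I_N] stays fixed while the bound drops from
    [b] to [x]. *)
Lemma sum_path_geq N d b : (b < N)%N ->
  \sum_(j : d.-tuple 'I_N | path geq b (map val j)) \prod_(x <- j) f (val x) =
  hsum d b.
Proof.
elim: d b => [|d IHd] b ltbN.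
  rewrite (big_pred1 [tuple]) => [|t]; first by rewrite big_nil.
  by rewrite tuple0 /= eqxx.
rewrite (@big_tupleS _ d (fun j => path geq b (map val j))
  (fun j => \prod_(x <- j) f (val x))) /=.
rewrite (big_ord_widen N (fun x => f x * hsum d x)) //.
rewrite [RHS]big_mkcond; apply: eq_bigr => x _; rewrite ltnS.
case: leqP => [lexb|_]; last by rewrite big_pred0.
rewrite -IHd // big_distrr; apply: eq_bigr => j _.
by rewrite big_cons.
Qed.

Lemma sum_sorted_leq d k :
  \sum_(j : d.-tuple 'I_k.+1 | sorted leq (map val j))
    \prod_(i < d) f (tnth j i) = hsum d k.
Proof.
have revK : involutive (fun j : d.-tuple 'I_k.+1 => rev_tuple j).
  by move=> j; apply: val_inj; rewrite /= revK.
rewrite (reindex_inj (inv_inj revK)) -(@sum_path_geq k.+1) //.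
apply: eq_big => [j|j _]; last first.
  by rewrite -(big_tuple _ _ (rev_tuple j) xpredT (fun x => f (val x))) big_rev.
(* After reversal, [path geq k] asks in addition only that the head be at most [k], which holds in
   ['I_k.+1]. *)
rewrite /= map_rev rev_sorted; case: j => [[|x s] /= _] //.
by rewrite -ltnS ltn_ord.
Qed.

End CompleteHomogeneous.

Lemma qrWhitney2_hsum (F : fieldType) (m r q : F) n k : (k <= n)%N ->
  qrWhitney2 m r q n k =
  q ^+ 'C(k, 2) * hsum F (fun j => m * qnum q j + r) (n - k) k.
Proof.
elim: n k => [|n IHn] [|k] //= lekn; rewrite ?bin0n ?expr0 ?mul1r //.
  by rewrite add0r IHn // subn0 expr0 mul1r -hsumS0.
(* The factor [q ^+ k] of the recurrence is the increment of ['C(k, 2)] to ['C(k.+1, 2)]. *)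
rewrite subSS binS bin1 exprD IHn //.
(* On the diagonal [k = n], [IHn] does not reach the second term, but that term vanishes. *)
move: lekn; rewrite ltnS leq_eqVlt => /predU1P[->|ltkn].
  by rewrite qrWhitney2_small // subnn /=; ring.
by rewrite IHn // -(subnSK ltkn) hsumSS binS bin1 exprD; ring.
Qed.

Theorem theorem4 (R : realType) (q m r : R[i]) (hq0 : q != 0) (hq1 : q != 1)
    (n k : nat) (hkn : (k <= n)%N) :
  qrWhitney2 m r q n k =
  q ^+ 'C(k, 2) *
  \sum_(j : (n - k).-tuple 'I_k.+1 | sorted leq (map val j))
    \prod_(i < n - k) (m * qnum q (tnth j i) + r).
Proof.
by rewrite qrWhitney2_hsum // -sum_sorted_leq.
Qed.
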